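(* Let $P\subset\mathbb R^n$ be a polytope containing $0$ in its interior, with Ricci affine function $\ell=\ell_P$. Suppose that $\ell_P\ge0$ on $P$. Then for any $\epsilon\in(0,1)$ there is a constant $C_\epsilon>0$, depending on $P$ and $\epsilon$, such that $$D_\ell(\phi)\ge\epsilon\int_P\phi^*\ell\,dy-C_\epsilon$$ for all $\phi\in\mathcal E^1(P)$ such that $\phi\ge\phi(0)=0$. Then $D_\ell(\phi)\ge\epsilon J_\ell^T(\phi)-C_\epsilon$ for all $\phi\in\mathcal E^1(P)$. In particular, $D_\ell$ is bounded from below.
   Context: $\psi_P(x)=\sup_{y\in P}\langle x,y\rangle$; $\phi^*(y)=\sup_{x\in\mathbb R^n}(\langle x,y\rangle-\phi(x))$; $\mathrm{PSH}(P)=\{\phi:\mathbb R^n\to\mathbb R\text{ convex}\mid\phi\le\psi_P+C\text{ for some }C\}$; $\mathcal E^1(P)=\{\phi\in\mathrm{PSH}(P)\mid\int_P\phi^*dy<\infty\}$. The Ricci affine function $\ell_P$ is the unique affine function with $-h(0)+\int_Ph\,\ell_P\,dy=0$ for all affine $h$. The modified Ding functional is $D_\ell(\phi)=-\log\int_{\mathbb R^n}e^{-\phi}dx+\int_P\phi^*\ell\,dy$ for $\phi\in\mathcal E^1(P)$. The modified reduced J-functional is $J_\ell^T(\phi)=\inf\{\int_P(\phi^*-l)\,\ell\,dy-\inf_P(\phi^*-l)\mid l\text{ affine}\}$. *)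

(* Defs.v *)
From HB Require Import structures.
From mathcomp Require Import all_boot all_order all_algebra.
From mathcomp Require Import all_classical all_reals all_analysis.

Set Implicit Arguments.
Unset Strict Implicit.
Unset Printing Implicit Defensive.
Import Order.TTheory GRing.Theory Num.Theory.
Import numFieldNormedType.Exports.

Local Open Scope classical_set_scope.
Local Open Scope ring_scope.

Fact rV_display : measure_display. Proof. exact: default_measure_display. Qed.

(* 'rV[R]_n carries the product sigma-algebra generated by the coordinate
   maps, as the library does for tuples; since the sigma-algebra of
   measurableTypeR R is the Borel one, so is this one. *)
Section measurable_rV.
Context {R : realType} {n : nat}.

Definition rV_coord (i : 'I_n) (v : 'rV[R]_n) : measurableTypeR R := v ord0 i.

Let rV_set0 : g_sigma_preimage rV_coord set0.
Proof. exact: sigma_algebra0. Qed.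

Let rV_setC A : g_sigma_preimage rV_coord A -> g_sigma_preimage rV_coord (~` A).
Proof. exact: sigma_algebraC. Qed.

Let rV_bigcup (F : _^nat) : (forall i, g_sigma_preimage rV_coord (F i)) ->
  g_sigma_preimage rV_coord (\bigcup_i (F i)).
Proof. exact: sigma_algebra_bigcup. Qed.

HB.instance Definition _ := @isMeasurable.Build rV_display
  'rV[R]_n (g_sigma_preimage rV_coord) rV_set0 rV_setC rV_bigcup.

Lemma measurable_rV_coord (i : 'I_n) : measurable_fun setT (rV_coord i).
Proof.
move=> _ Y mY; rewrite setTI; apply: sub_sigma_algebra => /=.
rewrite -bigcup_seq/=; exists i => /=; first by rewrite mem_index_enum.
by exists Y => //; rewrite setTI.
Qed.

Lemma measurable_fun_rV d (T : measurableType d) (f : T -> 'rV[R]_n) :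
  (forall i, measurable_fun setT (rV_coord i \o f)) -> measurable_fun setT f.
Proof.
move=> mf _ A mA; rewrite setTI.
suff : [set B | measurable (f @^-1` B)] A by [].
move: A mA; apply: smallest_sub.
  split=> /=; first by rewrite preimage_set0.
    by move=> B mB; rewrite setTD preimage_setC; exact: measurableC.
  by move=> F mF; rewrite preimage_bigcup; exact: bigcupT_measurable.
rewrite -bigcup_seq => B [i _ [C mC <-]] /=.
by rewrite setTI -comp_preimage -[X in measurable X]setTI; exact: mf.
Qed.

Lemma measurable_rV_box (A : 'I_n -> set (measurableTypeR R)) :
  (forall i, measurable (A i)) ->
  measurable [set v : 'rV[R]_n | forall i, A i (v ord0 i)].
Proof.
move=> mA.
rewrite (_ : [set v | _] = \big[setI/setT]_(i < n) (rV_coord i @^-1` A i)).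
  apply: bigsetI_measurable => i _.
  by rewrite -[X in measurable X]setTI; exact: measurable_rV_coord.
apply/seteqP; split => v /=; rewrite -bigcap_seq.
  by move=> H i _; exact: H.
by move=> H i; apply: H; rewrite /= mem_index_enum.
Qed.

End measurable_rV.

Section lebesgue_rV.
Context {R : realType}.

Definition cons_rV n (xv : measurableTypeR R * 'rV[R]_n) : 'rV[R]_n.+1 :=
  row_mx (xv.1 : R)%:M xv.2.

Definition uncons_rV n (w : 'rV[R]_n.+1) : measurableTypeR R * 'rV[R]_n :=
  (lsubmx (w : 'rV[R]_(1 + n)) ord0 ord0, rsubmx (w : 'rV[R]_(1 + n))).

Lemma cons_rV0 n xv : @cons_rV n xv ord0 ord0 = xv.1.
Proof.
rewrite (_ : ord0 = lshift n (ord0 : 'I_1)); last exact: val_inj.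
by rewrite [LHS]row_mxEl mxE eqxx mulr1n.
Qed.

Lemma cons_rVS n xv i : @cons_rV n xv ord0 (lift ord0 i) = xv.2 ord0 i.
Proof.
rewrite (_ : lift ord0 i = rshift 1 i); last exact: val_inj.
exact: row_mxEr.
Qed.

Lemma cons_rVK n : cancel (@cons_rV n) (@uncons_rV n).
Proof.
by move=> [x v]; rewrite /uncons_rV row_mxKl row_mxKr mxE eqxx mulr1n.
Qed.

Lemma measurable_cons_rV n : measurable_fun setT (@cons_rV n).
Proof.
apply: measurable_fun_rV => i.
rewrite -(@splitK 1 n i); case: (fintype.split (i : 'I_(1 + n))) => j /=.
- rewrite (_ : _ \o _ = fst).
    exact: measurable_fst.
  apply/funext => -[x v] /=.
  by rewrite /rV_coord [LHS]row_mxEl mxE !ord1 eqxx mulr1n.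
- rewrite (_ : _ \o _ = rV_coord j \o snd).
    by apply: measurableT_comp => //; exact: measurable_rV_coord.
  by apply/funext => -[x v] /=; rewrite /rV_coord [LHS]row_mxEr.
Qed.

Lemma measurable_uncons_rV n : measurable_fun setT (@uncons_rV n).
Proof.
apply/measurable_fun_pairP; split => /=.
  rewrite (_ : _ \o _ = rV_coord (lshift n (ord0 : 'I_1))).
    exact: measurable_rV_coord.
  by apply/funext => w /=; rewrite /rV_coord mxE.
apply: measurable_fun_rV => i.
rewrite (_ : _ \o _ = rV_coord (rshift 1 i)).
  exact: measurable_rV_coord.
by apply/funext => w /=; rewrite /rV_coord mxE.
Qed.

Lemma uncons_rVK n : cancel (@uncons_rV n) (@cons_rV n).
Proof.
move=> w; rewrite /cons_rV /= -mx11_scalar. exact: (@hsubmxK _ 1 1 n w).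
Qed.

Section lebesgue_rV_step.
Variables (n : nat) (mu : {sigma_finite_measure set 'rV[R]_n -> \bar R}).

Let nu := pushforward (lebesgue_measure \x mu)%E (@cons_rV n).

Let nu0 : nu set0 = 0%E.
Proof. by rewrite /nu /pushforward preimage_set0 measure0. Qed.

Let nu_ge0 A : (0 <= nu A)%E.
Proof. by rewrite /nu /pushforward measure_ge0. Qed.

Let mcons (A : set 'rV[R]_n.+1) :
  measurable A -> measurable (@cons_rV n @^-1` A).
Proof.
by move=> mA; rewrite -[X in measurable X]setTI; exact: measurable_cons_rV.
Qed.

Let nu_sigma_additive : semi_sigma_additive nu.
Proof.
move=> F mF tF mUF; rewrite /nu /pushforward preimage_bigcup.
apply: measure_semi_sigma_additive.
- by move=> i; exact: mcons.
- apply/trivIsetP => /= i j _ _ ij; rewrite -preimage_setI.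
  by move/trivIsetP : tF => /(_ _ _ _ _ ij) ->//; rewrite preimage_set0.
- by rewrite -preimage_bigcup; exact: mcons.
Qed.

HB.instance Definition _ := isMeasure.Build _ _ _ nu
  nu0 nu_ge0 nu_sigma_additive.

Let nu_sigma_finite : sigma_finite setT nu.
Proof.
have /sigma_finiteP[F [TF ndF Foo]] := sigma_finiteT (@lebesgue_measure R).
have /sigma_finiteP[G [TG ndG Goo]] := sigma_finiteT mu.
exists (fun i => @uncons_rV n @^-1` (F i `*` G i)).
  rewrite -preimage_bigcup -(preimage_setT (@uncons_rV n)); congr preimage.
  rewrite -setXTT TF TG predeqE => -[x y]; split.
    move=> [/= [p _ Fx] [q _ Gy]]; exists (maxn p q) => //; split.
      by move: x Fx; exact/subsetPset/ndF/leq_maxl.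
    by move: y Gy; exact/subsetPset/ndG/leq_maxr.
  by move=> [p _ []/= ? ?]; split; exists p.
move=> i; have [mF Fi] := Foo i; have [mG Gi] := Goo i; split.
  rewrite -[X in measurable X]setTI; apply: measurable_uncons_rV => //.
  exact: measurableX.
rewrite /nu /pushforward -comp_preimage (_ : _ \o _ = id); last first.
  by apply/funext => x /=; rewrite cons_rVK.
by rewrite preimage_id product_measure1E// lte_mul_pinfty// ge0_fin_numE.
Qed.

HB.instance Definition _ := Measure_isSigmaFinite.Build _ _ _ nu
  nu_sigma_finite.

Definition lebesgue_rV_step : {sigma_finite_measure set 'rV[R]_n.+1 -> \bar R} :=
  nu.

End lebesgue_rV_step.

(* n-fold product of the one-dimensional Lebesgue measure, transported along
   R * 'rV[R]_n ~ 'rV[R]_n.+1; for n = 0 it is the unit mass. *)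
Fixpoint lebesgue_rV n : {sigma_finite_measure set 'rV[R]_n -> \bar R} :=
  if n is m.+1 then lebesgue_rV_step (lebesgue_rV m) else \d_ (0 : 'rV[R]_0).

Lemma lebesgue_rV_box n (A : 'I_n -> set (measurableTypeR R)) :
  (forall i, measurable (A i)) ->
  lebesgue_rV n [set v | forall i, A i (v ord0 i)] =
  (\prod_(i < n) lebesgue_measure (A i))%E.
Proof.
elim: n A => [|n ih] A mA.
  by rewrite big_ord0 /= diracE mem_set//= => -[].
rewrite big_ord_recl -(ih (fun i => A (lift ord0 i)))//.
rewrite -product_measure1E//; last first.
  exact: (@measurable_rV_box R n (fun i => A (lift ord0 i))).
rewrite /= /lebesgue_rV_step /pushforward; congr (_ _).
apply/seteqP; split => -[x v] /= H.
  split; first by have := H ord0; rewrite cons_rV0.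
  by move=> i; have := H (lift ord0 i); rewrite cons_rVS.
move=> i; case: (unliftP ord0 i) => [j ->|->]; first by rewrite cons_rVS; case: H.
by rewrite cons_rV0; case: H.
Qed.

End lebesgue_rV.

Section ding.
Context {R : realType} {n : nat}.
Implicit Types (P : set 'rV[R]_n) (phi ell h : 'rV[R]_n -> R).

Definition dotr (x y : 'rV[R]_n) : R := \sum_(i < n) x ord0 i * y ord0 i.

Definition polytope P : Prop :=
  exists2 V : set 'rV[R]_n, finite_set V & P = smallest (@convex_set R _) V.

Definition affine_fun h : Prop :=
  exists (a : 'rV[R]_n) (b : R), forall y, h y = dotr a y + b.

Local Open Scope ereal_scope.

Definition support_fun P (x : 'rV[R]_n) : \bar R :=
  ereal_sup [set (dotr x y)%:E | y in P].

Definition legendre phi (y : 'rV[R]_n) : \bar R :=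
  ereal_sup [set (dotr x y - phi x)%:E | x in setT].

Definition PSH P : set ('rV[R]_n -> R) :=
  [set phi | @convex_function R 'rV[R]_n setT phi /\
    exists C : R, forall x, (phi x)%:E <= support_fun P x + C%:E].

(* legendre phi >= - phi 0, and polytopes have finite volume, so for them the
   integral is never an indeterminate form. *)
Definition finite_energy P : set ('rV[R]_n -> R) :=
  [set phi | PSH P phi /\
    \int[lebesgue_rV n]_(y in P) legendre phi y < +oo].

(* These conditions determine at most one affine function when P has nonempty
   interior: the L^2(P) pairing on affine functions is then nondegenerate. *)
Definition is_ricci_affine P ell : Prop :=
  affine_fun ell /\
  forall h, affine_fun h ->
    - (h 0%R)%:E + \int[lebesgue_rV n]_(y in P) (h y * ell y)%:E = 0.

(* Wherever legendre phi = +oo and ell = 0, the product is 0. *)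
Definition ding P ell phi : \bar R :=
  - lne (\int[lebesgue_rV n]_x (expR (- phi x))%:E) +
  \int[lebesgue_rV n]_(y in P) (legendre phi y * (ell y)%:E).

Definition reduced_J P ell phi : \bar R :=
  ereal_inf [set \int[lebesgue_rV n]_(y in P)
                   ((legendre phi y - (l y)%:E) * (ell y)%:E)
                 - ereal_inf [set legendre phi y - (l y)%:E | y in P]
            | l in affine_fun].

End ding.

(* Main.v *)
Require Import Defs.
From HB Require Import structures.
From mathcomp Require Import all_boot all_order all_algebra.
From mathcomp Require Import all_classical all_reals all_analysis.
From mathcomp Require Import measurable_realfun ring lra.

Set Implicit Arguments.
Unset Strict Implicit.
Unset Printing Implicit Defensive.
Import Order.TTheory GRing.Theory Num.Theory.
Import numFieldNormedType.Exports.

Local Open Scope classical_set_scope.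
Local Open Scope ring_scope.

(** Write [m(a)] for the integral over [P] of [(phi^* - l_a) ell], where
    [l_a(y) = <a, y> - phi(a)] is an affine minorant of the Legendre transform
    [phi^*].  The Ricci condition says that [ell dy] is a measure on [P] of
    total mass 1 with barycentre 0, so this tilt changes the energy only by a
    constant: [m(a)] is the energy plus [phi(a)].

    Suppose that [a] minimises [phi] up to an error 1.  Then both
    [u(x) = phi(x) - phi(a) + 1] and [phi^* - l_a] are nonnegative, and
    Young's inequality [phi(x) + phi^*(y) >= <x, y>] improves to
    [u(x) + (phi^* - l_a)(y) >= max(<x - a, y>, 0)].  Integrating in [y]
    against [ell dy] gives [u(x) + m(a) >= N(x - a)], where [N(z)] is the
    integral of [max(<z, y>, 0) ell].  As [ell] is bounded below by a positive
    constant near 0, the orthant of [y] having the signs of [z] already gives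
    [N(z) >= r |z|_1] for some [r > 0] (lemma [integral_dotr_pos_ge]).  This is
    [growth_almost_min]; the coefficient of [m(a)] in it is exactly 1.

    Since [u >= 0], also [u >= (1 - eps) u], so
    [exp(-phi(x)) <= exp(1 - phi(a) + (1 - eps) m(a) - (1 - eps) r |x - a|_1)].
    The last exponential has an integral that does not depend on [a]
    (lemma [integral_expR_l1]), and taking logarithms gives
    [D(phi) >= eps m(a) - C] with [C] independent of [phi] and [a]: this is
    [ding_coercive], from which all three claims follow.  If
    [phi >= phi(0) = 0], take [a = 0], where the tilt vanishes.  In general
    [m(a)] bounds the reduced J-functional, which is an infimum over all
    affine tilts, and [m(a) >= 0] gives the lower bound of [D].  An almost
    minimiser exists because [m(x) >= 0] for every [x] says that [phi] is
    bounded below by minus its energy (lemma [finite_energy_almost_min]). *)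

(** * Lebesgue measure on row vectors *)

(** The product sigma-algebra contains the open sets because each open set is
    the union of the countably many boxes with rational corners inside it. *)
Lemma open_measurable_rV (R : realType) n (U : set 'rV[R]_n) :
  open U -> measurable U.
Proof.
move=> oU.
pose box (pq : 'rV[rat]_n * 'rV[rat]_n) := [set v : 'rV[R]_n |
  forall i, `]ratr (pq.1 ord0 i), ratr (pq.2 ord0 i)[%classic (v ord0 i)].
have mbox pq : measurable (box pq).
  apply: (@measurable_rV_box R n
    (fun i => `]ratr (pq.1 ord0 i), ratr (pq.2 ord0 i)[%classic)) => i.
  exact: measurable_itv.
rewrite (_ : U = \bigcup_pq (if `[< box pq `<=` U >] then box pq else set0)).
  apply: countable_bigcupT_measurable; first exact: countableP.
  by move=> pq; case: ifP => _; [exact: mbox | exact: measurable0].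
apply/seteqP; split => [x Ux|x [pq _]]; last by case: asboolP => // + ?; exact.
have /nbhs_ballP[e /= e0 eU] : nbhs x U by exact: open_nbhs_nbhs.
have /choice[p pP] (i : 'I_n) : exists q : rat, ratr q \in `]x ord0 i - e, x ord0 i[.
  by apply: rat_in_itvoo; rewrite ltrBlDr ltrDl.
have /choice[q qP] (i : 'I_n) : exists q : rat, ratr q \in `]x ord0 i, x ord0 i + e[.
  by apply: rat_in_itvoo; rewrite ltrDl.
exists (\row_i p i, \row_i q i) => //; rewrite asboolT.
  move=> i /=; rewrite !mxE in_itv/=.
  by have := pP i; have := qP i; rewrite !in_itv/= => /andP[-> _] /andP[_ ->].
move=> v vpq; apply: eU; split=> // i j; rewrite ord1.
have := vpq j; rewrite /= !mxE in_itv/= => /andP[pv vq].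
have := pP j; have := qP j; rewrite !in_itv/= => /andP[_ qe] /andP[pe _].
by rewrite /ball/= ltr_distlC (lt_trans pe pv) (lt_trans vq qe).
Qed.

(** Translation invariance comes from the substitution [t |-> t - a], and each
    half-line contributes the mass of an exponential density divided by [k]. *)
Lemma integral_expR_absB (R : realType) (k a : R) : 0 < k ->
  (\int[lebesgue_measure]_t (expR (- (k * `|t - a|)))%:E = (2 / k)%:E)%E.
Proof.
move=> k0.
have cabs : continuous (fun t : R => expR (- (k * `|t|))).
  move=> t; apply: continuous_comp; last exact: continuous_expR.
  by apply: continuousN; apply: continuousM; [|exact: norm_continuous];
    exact: cst_continuous.
have dB : derive1 (fun t : R => t - a) = cst 1.
  apply/funext => t; rewrite derive1E deriveB// derive_id derive_cst subr0//.
transitivity (\int[lebesgue_measure]_t (expR (- (k * `|t|)))%:E)%E.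
  rewrite [RHS](@increasing_ge0_integration_by_substitutionT _ (fun t => t - a))//=.
  - by apply: eq_integral => t _ /=; rewrite !fctE dB/= mulr1.
  - by move=> x y xy; rewrite ltrD2r.
  - by rewrite dB; exact: cst_continuous.
  - by rewrite dB; exact: is_cvg_cst.
  - by rewrite dB; exact: is_cvg_cst.
  - exact: cvg_addrr_Ny.
  - exact: cvg_addrr.
rewrite ge0_symfun_integralT//; last by move=> t/=; rewrite normrN.
rewrite -set_itvcy.
transitivity (2%:E *
  (k^-1%:E * \int[lebesgue_measure]_t (exponential_pdf k t)%:E))%E; last first.
  by rewrite integral_exponential_pdf// mule1.
congr *%E; rewrite -ge0_integralZl//; last 3 first.
  by apply/measurable_EFinP; exact: measurable_exponential_pdf.
  by move=> t _; rewrite lee_fin exponential_pdf_ge0// ltW.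
  by rewrite lee_fin invr_ge0 ltW.
rewrite [LHS]integral_mkcond; apply: eq_integral => t _.
rewrite /exponential_pdf !patchE; case: ifPn; last by rewrite mule0.
rewrite inE/= in_itv/= andbT => t0.
by rewrite -EFinM mulrA mulVf ?gt_eqF// mul1r ger0_norm// mulNr.
Qed.

Lemma measurable_expR_l1 (R : realType) n (k : R) (a : 'rV[R]_n) :
  measurable_fun setT (fun x : 'rV[R]_n =>
    (expR (- (k * \sum_(i < n) `|x ord0 i - a ord0 i|)))%:E).
Proof.
apply/measurable_EFinP; apply: measurableT_comp => //.
apply: measurableT_comp => //; apply: measurable_funM => //.
apply: measurable_sum => i; apply: measurableT_comp => //.
by apply: measurable_funB => //; exact: measurable_rV_coord.
Qed.

(** The integrand is a product of functions of one coordinate each, so Tonelli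
    reduces the integral to one-dimensional ones; the value is independent of
    the centre [a]. *)
Lemma integral_expR_l1 (R : realType) n (k : R) (a : 'rV[R]_n) : 0 < k ->
  (\int[lebesgue_rV n]_x
     (expR (- (k * \sum_(i < n) `|x ord0 i - a ord0 i|)))%:E =
   ((2 / k) ^+ n)%:E)%E.
Proof.
move=> k0.
elim: n a => [a|n ih a].
  under eq_integral do rewrite big_ord0 mulr0 oppr0 expR0.
  by rewrite integral_cst//= diracE mem_set// mule1 expr0.
rewrite /= [LHS](ge0_integral_pushforward (@measurable_cons_rV R n))//=; last first.
  exact: measurable_expR_l1.
rewrite preimage_setT fubini_tonelli1//=; last first.
  exact: measurableT_comp (measurable_expR_l1 k a) (@measurable_cons_rV R n).
pose b := (uncons_rV a).2.
rewrite exprS EFinM -(integral_expR_absB (a ord0 ord0) k0).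
have E t (x : 'rV[R]_n) :
    ((expR (- (k * \sum_(i < n.+1) `|cons_rV (t, x) ord0 i - a ord0 i|)))%:E =
     (expR (- (k * `|t - a ord0 ord0|)))%:E *
     (expR (- (k * \sum_(i < n) `|x ord0 i - b ord0 i|)))%:E)%E.
  rewrite big_ord_recl cons_rV0 mulrDr opprD expRD EFinM.
  congr (_ * (expR (- (k * _)))%:E)%E.
  apply: eq_bigr => i _; rewrite cons_rVS /b/= mxE; congr `|_ - a _ _|.
  exact/val_inj.
rewrite /fubini_F.
under eq_integral => t _.
  under eq_integral => x _ do rewrite E.
  rewrite ge0_integralZl//; [|exact: measurable_expR_l1].
  rewrite ih muleC.
  over.
rewrite ge0_integralZl//; last 2 first.
  - apply/measurable_EFinP; apply: measurableT_comp => //.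
    apply: measurableT_comp => //; apply: measurable_funM => //.
    apply: measurableT_comp => //.
    by apply: measurable_funB.
  - by rewrite lee_fin exprn_ge0// divr_ge0// ltW.
by rewrite muleC.
Qed.

(** * Polytopes *)

Lemma convex_setP (R : realType) (M : lmodType R) (A : set M) :
  @convex_set R M A <->
  (forall x y t, 0 <= t -> t <= 1 -> A x -> A y -> A (t *: x + (1 - t) *: y)).
Proof.
split=> [cA x y t t0 t1 Ax Ay|cA x y t /set_mem Ax /set_mem Ay]; last first.
  by apply/mem_set; apply: cA.
have t01 : Itv.spec (@Itv.num_sem R) (Itv.Real `[0%Z, 1%Z]) t.
  by rewrite /Itv.spec/= /Itv.num_sem/= num_real/= in_itv/= t0 t1.
by have /set_mem := cA x y (Itv.mk t01) (mem_set Ax) (mem_set Ay).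
Qed.

Lemma convex_cone_over (R : realType) (M : lmodType R) (K : set M) (v : M) :
  @convex_set R M K ->
  @convex_set R M [set t *: v + (1 - t) *: k | t in `[0, 1] & k in K].
Proof.
move=> /convex_setP cK; apply/convex_setP => x y l l0 l1.
move=> [s s01 [k Kk <-{x}]] [s' s01' [k' Kk' <-{y}]].
move: s01 s01'; rewrite /= !in_itv/= => /andP[s0 s1] /andP[s0' s1'].
pose w := l * (1 - s) + (1 - l) * (1 - s').
have p0 : 0 <= l * (1 - s) by rewrite mulr_ge0// subr_ge0.
have q0 : 0 <= (1 - l) * (1 - s') by rewrite mulr_ge0// subr_ge0.
have lw : 1 - w = l * s + (1 - l) * s' by rewrite /w; ring.
have w1 : 0 <= 1 - w by rewrite lw addr_ge0// mulr_ge0// subr_ge0.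
have w0 : 0 <= w by rewrite addr_ge0.
exists (1 - w); first by rewrite /= in_itv/= w1/= lerBlDr lerDl.
(* When w = 0 both points carry all their weight on v. *)
have [w_eq0|w_neq0] := eqVneq w 0.
  exists k => //.
  have /andP[/eqP pe /eqP qe] : (l * (1 - s) == 0) && ((1 - l) * (1 - s') == 0).
    by rewrite -paddr_eq0// -/w w_eq0.
  rewrite subKr w_eq0 scale0r addr0 subr0.
  rewrite !scalerDr !scalerA pe qe !scale0r !addr0 -scalerDl -lw w_eq0 subr0.
  by [].
exists ((l * (1 - s) / w) *: k + (1 - l * (1 - s) / w) *: k').
  apply: cK => //; first by rewrite divr_ge0.
  by rewrite ler_pdivrMr ?lt_def ?w_neq0// mul1r lerDl.
have -> : 1 - l * (1 - s) / w = (1 - l) * (1 - s') / w.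
  by rewrite -[X in X - _](divff w_neq0) -mulrBl {1}/w addrC addKr.
have wK z : w * (z / w) = z by rewrite mulrC divfK.
rewrite subKr lw !scalerDr !scalerA !wK.
by rewrite scalerDl addrACA.
Qed.

(** The right-hand side is convex and lies between [v |` V] and its hull.  It
    contains [v] only because the hull of [V] has at least one point. *)
Lemma hull_cons (R : realType) (M : lmodType R) (v : M) (V : set M) :
  V !=set0 ->
  smallest (@convex_set R M) (v |` V) =
  [set t *: v + (1 - t) *: k | t in `[0, 1] & k in smallest (@convex_set R M) V].
Proof.
move=> [v0 Vv0].
have hc W : @convex_set R M (smallest (@convex_set R M) W).
  apply/convex_setP => x y t t0 t1 Wx Wy A [cA WA].
  by move/convex_setP : (cA); apply => //; [apply: Wx | apply: Wy].
apply/seteqP; split.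
  apply: smallest_sub; first exact/convex_cone_over/hc.
  move=> x [->{x}|Vx].
    exists 1; first by rewrite /= in_itv/= ler01 lexx.
    exists v0; first exact: sub_gen_smallest.
    by rewrite scale1r subrr scale0r addr0.
  exists 0; first by rewrite /= in_itv/= ler01 lexx.
  by exists x; [exact: sub_gen_smallest | rewrite scale0r add0r subr0 scale1r].
move=> x [t /=]; rewrite in_itv/= => /andP[t0 t1] [k Vk <-{x}].
move/convex_setP: (hc (v |` V)); apply => //.
  by apply: sub_gen_smallest; left.
by apply: (sub_smallest2r (hc _)) Vk => x Vx; right.
Qed.

(** By induction on the generators: adding one replaces the hull by the image
    of a product of compact sets under [(t, k) |-> t v + (1 - t) k]. *)
Lemma compact_polytope (R : realType) n (P : set 'rV[R]_n) :
  polytope P -> P !=set0 -> compact P.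
Proof.
move=> [V /finite_seqP[s ->] ->].
case: s => [|v s].
  rewrite set_nil smallest_id; first by case=> x [].
  by apply/convex_setP.
(* The induction keeps one generator aside so that every hull is nonempty. *)
move=> _; elim: s v => [|v' s ih] v.
  rewrite set_cons1 smallest_id; first exact: compact_set1.
  apply/convex_setP => x y t _ _ -> ->.
  by rewrite /= -scalerDl addrC subrK scale1r.
have -> : [set` v :: v' :: s] = v |` [set` v' :: s].
  by apply/seteqP; split=> y /=; rewrite (in_cons v) => /predU1P.
rewrite hull_cons; last by exists v'; rewrite /= mem_head.
have cf : continuous (fun tk : R * 'rV[R]_n => tk.1 *: v + (1 - tk.1) *: tk.2).
  move=> tk; apply: cvgD; apply: cvgZ.
  - exact: cvg_fst.
  - exact: cvg_cst.
  - by apply: cvgB; [exact: cvg_cst | exact: cvg_fst].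
  - exact: cvg_snd.
have := continuous_compact (continuous_subspaceT cf)
  (compact_setX (@segment_compact R 0 1) (ih v')).
congr compact; apply/seteqP; split.
  by move=> x [[t k] /= [? ?] <-{x}]; exists t => //; exists k.
by move=> x [t ? [k ? <-{x}]]; exists (t, k).
Qed.

(** The Borel sigma-algebra is not complete, so convexity alone would not do:
    the boundary of a convex set need not be Borel.  Here the set is closed. *)
Lemma measurable_polytope (R : realType) n (P : set 'rV[R]_n) :
  polytope P -> P !=set0 -> measurable P.
Proof.
move=> pP P0; rewrite -[P]setCK; apply: measurableC; apply: open_measurable_rV.
by rewrite openC; apply: compact_closed (compact_polytope pP P0); exact: norm_hausdorff.
Qed.

(** A sublevel set of an affine function is convex, so it contains the hull as
    soon as it contains the generators. *)
Lemma affine_bounded_polytope (R : realType) n (P : set 'rV[R]_n) h :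
  polytope P -> affine_fun h -> exists M : R, forall y, P y -> h y <= M.
Proof.
move=> [V fV ->] [a [b hE]].
have [M VM] : exists M : R, forall y, V y -> h y <= M.
  have /finite_seqP[s sE] := fV.
  exists (\big[Num.max/0]_(y <- s) h y) => y; rewrite sE/= => ys.
  exact: le_bigmax_seq.
exists M => y Py; apply: (Py [set y | h y <= M]); split => //.
apply/convex_setP => x z t t0 t1 /= hx hz.
have -> : h (t *: x + (1 - t) *: z) = t * h x + (1 - t) * h z.
  rewrite !hE.
  have -> : dotr a (t *: x + (1 - t) *: z) = t * dotr a x + (1 - t) * dotr a z.
    rewrite /dotr !mulr_sumr -big_split/=; apply: eq_bigr => i _.
    by rewrite !mxE; ring.
  ring.
nra.
Qed.

Lemma volume_polytope_fin (R : realType) n (P : set 'rV[R]_n) :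
  polytope P -> P !=set0 -> (lebesgue_rV n P < +oo)%E.
Proof.
move=> pP P0.
have coord_le (c : R) : exists M : 'I_n -> R, forall i y, P y -> c * y ord0 i <= M i.
  suff /choice[M MP] : forall i : 'I_n, exists M : R, forall y, P y -> c * y ord0 i <= M.
    by exists M.
  move=> i; apply: affine_bounded_polytope pP _.
  exists (\row_j (c *+ (j == i))), 0 => y.
  rewrite addr0 /dotr (bigD1 i)//= mxE eqxx mulr1n big1 ?addr0// => j ji.
  by rewrite mxE (negbTE ji) mulr0n mul0r.
have [M MP] := coord_le 1; have [N NP] := coord_le (-1).
apply: (@le_lt_trans _ _
    (lebesgue_rV n [set v | forall i, `[- N i, M i]%classic (v ord0 i)])).
  apply: le_measure; rewrite ?inE//.
  - exact: measurable_polytope.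
  - apply: (@measurable_rV_box R n (fun i => `[- N i, M i]%classic)) => i.
    exact: measurable_itv.
  - move=> y Py i /=; rewrite in_itv/=.
    by have := MP i _ Py; have := NP i _ Py; rewrite mul1r mulN1r lerNl => -> ->.
rewrite (lebesgue_rV_box (A := fun i => `[- N i, M i]%classic)); last first.
  by move=> i; exact: measurable_itv.
suff : (\prod_(i < n) lebesgue_measure (`[(- N i)%R, M i]%classic : set R))%E \is a fin_num.
  by move=> /fin_numPlt /andP[].
apply: (big_ind (fun x : \bar R => x \is a fin_num)) => //.
  by move=> *; rewrite fin_numM.
by move=> i _; rewrite lebesgue_measure_itv/=; case: ifP.
Qed.

(** * Affine functions and the Legendre transform *)

Lemma dotr_continuous (R : realType) n (x : 'rV[R]_n) : continuous (dotr x).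
Proof.
rewrite (_ : dotr x = fun y : 'rV[R]_n => \sum_(i < n) x ord0 i * y ord0 i)//.
apply: continuous_big => [|i _ y]; first by move=> u; exact: cvgD cvg_fst cvg_snd.
by apply: continuousM; [exact: cst_continuous | exact: coord_continuous].
Qed.

Lemma measurable_affine (R : realType) n (h : 'rV[R]_n -> R) :
  affine_fun h -> measurable_fun setT h.
Proof.
move=> [a [b hE]]; rewrite (_ : h = fun y => dotr a y + b); last exact/funext.
apply: measurable_funD => //; apply: measurable_sum => i.
by apply: measurable_funM => //; exact: measurable_rV_coord.
Qed.

(** As a supremum of continuous functions it is lower semicontinuous: its strict
    superlevel sets are unions of open half-spaces. *)
Lemma measurable_legendre (R : realType) n (phi : 'rV[R]_n -> R) :
  measurable_fun setT (legendre phi).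
Proof.
apply: (measurability _ (ErealGenOInfty.measurableE R)).
move=> /= _ [_ [r ->]] <-; rewrite setTI; apply: open_measurable_rV.
rewrite preimage_itvoy.
rewrite (_ : [set _ | _] = \bigcup_x [set y | r + phi x < dotr x y]).
  apply: bigcup_open => x _.
  apply: (@open_comp _ _ (dotr x) [set t | r + phi x < t]); last exact: open_gt.
  by move=> y _; exact: dotr_continuous.
apply/seteqP; split=> [y /= /ereal_sup_gt[_ [x _ <-]]|y [x _ /= xy]].
  by rewrite lte_fin ltrBrDr => xy; exists x.
apply: (@lt_le_trans _ _ (dotr x y - phi x)%:E); first by rewrite lte_fin ltrBrDr.
by apply: ereal_sup_ubound; exists x.
Qed.

Lemma le_legendre (R : realType) n (phi : 'rV[R]_n -> R) x y :
  ((dotr x y - phi x)%:E <= legendre phi y)%E.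
Proof. by apply: ereal_sup_ubound; exists x. Qed.

(** Here [f] may fail to be measurable: the integral of a nonnegative function
    is a supremum over the simple functions below it.  This serves to bound
    [exp(-phi)] by an explicit integrable function. *)
Lemma le_ge0_integral (d : measure_display) (T : measurableType d)
    (R : realType) (mu : {measure set T -> \bar R}) (f g : T -> \bar R) :
  (forall x, 0 <= f x)%E -> (forall x, f x <= g x)%E ->
  (\int[mu]_x f x <= \int[mu]_x g x)%E.
Proof.
move=> f0 fg; rewrite !ge0_integralTE//; last first.
  by move=> x; exact: le_trans (fg x).
by apply: le_ereal_sup => _ [h /= hf <-]; exists h => // x; exact: le_trans (fg x).
Qed.

Lemma affine_cst (R : realType) n (b : R) : affine_fun (fun _ : 'rV[R]_n => b).
Proof.
by exists 0, b => y; rewrite /dotr big1 ?add0r// => i _; rewrite mxE mul0r.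
Qed.

Lemma affine_dotrB (R : realType) n (a : 'rV[R]_n) (b : R) :
  affine_fun (fun y => dotr a y - b).
Proof. by exists a, (- b). Qed.

Lemma dotr0 (R : realType) n (a : 'rV[R]_n) : dotr a 0 = 0.
Proof. by rewrite /dotr big1// => i _; rewrite mxE mulr0. Qed.

Lemma affine_norm_bounded_polytope (R : realType) n (P : set 'rV[R]_n) h :
  polytope P -> affine_fun h -> exists M : R, forall y, P y -> `|h y| <= M.
Proof.
move=> pP ah; have [M hM] := affine_bounded_polytope pP ah.
have [|N hN] := @affine_bounded_polytope _ _ P (fun y => - h y) pP.
  have [a [b hE]] := ah; exists (- a), (- b) => y; rewrite hE opprD.
  by congr (_ - _); rewrite /dotr -sumrN; apply: eq_bigr => i _; rewrite mxE mulNr.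
exists (Num.max M N) => y Py.
by rewrite ler_norml lerNl !le_max hM// hN// orbT.
Qed.

Lemma integrable_affineM (R : realType) n (P : set 'rV[R]_n) h k :
  polytope P -> P !=set0 -> affine_fun h -> affine_fun k ->
  (lebesgue_rV n).-integrable P (fun y => (h y * k y)%:E).
Proof.
move=> pP P0 ah ak.
have [M hM] := affine_norm_bounded_polytope pP ah; have [N kN] := affine_norm_bounded_polytope pP ak.
have mP := measurable_polytope pP P0.
apply: (measurable_bounded_integrable mP (volume_polytope_fin pP P0)).
  by apply: measurable_funTS; apply: measurable_funM; exact: measurable_affine.
exists (M * N); split; first exact: num_real.
move=> x MNx y Py /=; rewrite normrM (le_trans _ (ltW MNx))// ler_pM//.
  exact: hM.
exact: kN.
Qed.

(** * The measure with density the Ricci affine function *)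

Lemma integral_ricci (R : realType) n (P : set 'rV[R]_n) ell h :
  is_ricci_affine P ell -> affine_fun h ->
  (\int[lebesgue_rV n]_(y in P) (h y * ell y)%:E = (h 0)%:E)%E.
Proof.
move=> [_ rP] ah; have := rP h ah.
case: (integral _ _ _) => [r| |]//= -[] /eqP.
by rewrite addrC subr_eq0 => /eqP ->.
Qed.

(** An affine function that is nonnegative near 0 and vanishes at 0 has no
    linear part, and [ell] is not 0 because its integral is 1; so [ell 0 > 0].
    Then [ell y = (ell (2 y) + ell 0) / 2 >= ell 0 / 2] as long as [2 y] stays
    in [P]. *)
Lemma ricci_affine_gt0 (R : realType) n (P : set 'rV[R]_n) ell :
  interior P 0 -> is_ricci_affine P ell -> (forall y, P y -> 0 <= ell y) ->
  exists d c : R, [/\ 0 < d, 0 < c &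
    forall y : 'rV[R]_n, (forall i, `|y ord0 i| <= d) -> P y /\ c <= ell y].
Proof.
move=> /nbhs_ballP[e /= e0 eP] rP ell0.
have {}eP (y : 'rV[R]_n) : (forall i, `|y ord0 i| < e) -> P y.
  move=> ye; apply: eP; split=> // i j; rewrite ord1 mxE.
  by rewrite /ball/= sub0r normrN.
have [a [b ellE]] := rP.1.
have dotrZ t y : dotr a (t *: y) = t * dotr a y.
  by rewrite /dotr mulr_sumr; apply: eq_bigr => i _; rewrite mxE mulrCA.
have P0 : P 0 by apply: eP => i; rewrite mxE normr0.
have b0 : 0 <= b by have := ell0 _ P0; rewrite ellE dotr0 add0r.
have {}b0 : 0 < b.
  rewrite lt_neqAle b0 andbT; apply/negP => /eqP b_eq0.
  have ellP0 y : P y -> ell y = 0.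
    move=> Py; apply/eqP; rewrite eq_le ell0// andbT.
    (* A small negative multiple of y is in P too; ell 0 = 0 makes ell odd. *)
    pose s := 1 + \sum_i `|y ord0 i|.
    have s0 : 0 < s by rewrite ltr_pwDl// sumr_ge0.
    have /ell0 : P (- (e / s) *: y).
      apply: eP => i; rewrite mxE normrM normrN (gtr0_norm (divr_gt0 e0 s0))//.
      rewrite mulrAC ltr_pdivrMr// ltr_pM2l// /s (bigD1 i)//=.
      by rewrite ltr_pwDl// lerDl sumr_ge0.
    rewrite !ellE dotrZ -b_eq0 !addr0 mulNr oppr_ge0.
    by rewrite pmulr_rle0// divr_gt0.
  have := integral_ricci rP (affine_cst n 1).
  rewrite integral0_eq => [[] /esym /eqP|y Py]; first by rewrite oner_eq0.
  by rewrite ellP0// mulr0.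
exists (e / 4), (b / 2); split; [by rewrite divr_gt0..|move=> y yd].
have {}yd i : `|2 * y ord0 i| < e.
  by rewrite normrM ger0_norm//; have := yd i; move: e0; lra.
split.
  apply: eP => i; have := yd i; rewrite normrM ger0_norm//.
  by have := normr_ge0 (y ord0 i); lra.
have /ell0 : P (2 *: y) by apply: eP => i; rewrite mxE.
by rewrite !ellE dotrZ; lra.
Qed.

(** The left-hand side is a multiple of the l1-norm of [z].  It suffices to
    integrate over the cube of side [d / 2], at distance [d / 2] from the
    coordinate hyperplanes, in the orthant of the vectors with the signs of
    [z]: there [z_i y_i >= (d / 2) |z_i|] for every [i]. *)
Lemma integral_dotr_pos_ge (R : realType) n (P : set 'rV[R]_n) ell :
  polytope P -> interior P 0 -> is_ricci_affine P ell ->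
  (forall y, P y -> 0 <= ell y) ->
  exists2 r : R, 0 < r & forall z : 'rV[R]_n,
    ((r * \sum_i `|z ord0 i|)%:E <=
     \int[lebesgue_rV n]_(y in P) (Num.max (dotr z y) 0 * ell y)%:E)%E.
Proof.
move=> pP P0 rP ell0.
have [d [c [d0 c0 dcP]]] := ricci_affine_gt0 P0 rP ell0.
have mP : measurable P.
  by apply: measurable_polytope => //; exists 0; exact: nbhs_singleton P0.
exists (c * (d / 2) * (d / 2) ^+ n) => [|z].
  by rewrite !(mulr_gt0, exprn_gt0, divr_gt0).
pose A i : set (measurableTypeR R) :=
  if 0 <= z ord0 i then `[d / 2, d]%classic else `[- d, - (d / 2)]%classic.
have mA i : measurable (A i) by rewrite /A; case: ifP => _; exact: measurable_itv.
pose Q := [set y : 'rV[R]_n | forall i, A i (y ord0 i)].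
have mQ : measurable Q := measurable_rV_box mA.
have Qd y : Q y -> forall i,
    `|y ord0 i| <= d /\ d / 2 * `|z ord0 i| <= z ord0 i * y ord0 i.
  move=> Qy i; have := Qy i; rewrite /A.
  case: leP => z0; rewrite /= in_itv/= => zi.
    have -> : `|z ord0 i| = z ord0 i by rewrite ger0_norm.
    move: zi => /andP[y1 y2]; split; last by nra.
    by rewrite ger0_norm//; lra.
  have -> : `|z ord0 i| = - z ord0 i by rewrite ltr0_norm.
  by move: zi => /andP[y1 y2]; rewrite ler0_norm; [split; nra|lra].
have QP : Q `<=` P by move=> y /Qd Qy; apply: (dcP y _).1 => i; exact: (Qy i).1.
have volQ : lebesgue_rV n Q = ((d / 2) ^+ n)%:E.
  rewrite [LHS](lebesgue_rV_box mA).
  have volA i : lebesgue_measure (A i) = (d / 2)%:E.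
    rewrite /A; case: ifP => _; rewrite lebesgue_measure_itv/= lte_fin ifT -?EFinD.
    - by congr EFin; lra.
    - by lra.
    - by congr EFin; lra.
    - by lra.
  rewrite (eq_bigr (fun=> (d / 2)%:E)) => [|i _]; last exact: volA.
  by rewrite prodEFin prodr_const card_ord.
have mf : measurable_fun P (fun y => (Num.max (dotr z y) 0 * ell y)%:E).
  apply/measurable_EFinP/measurable_funTS/measurable_funM; last first.
    exact: measurable_affine rP.1.
  apply: measurable_maxr => //.
  by apply: measurable_affine; exists z, 0 => y; rewrite addr0.
have f0 y : P y -> (0 <= (Num.max (dotr z y) 0 * ell y)%:E)%E.
  by move=> Py; rewrite lee_fin mulr_ge0 ?ell0// le_max lexx orbT.
apply: le_trans; last exact: (ge0_subset_integral (lebesgue_rV n) mQ mP mf f0 QP).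
pose K := c * (d / 2) * \sum_i `|z ord0 i|.
have K0 : 0 <= K by rewrite !mulr_ge0 ?sumr_ge0// ?divr_ge0// ltW.
rewrite (_ : _%:E = \int[lebesgue_rV n]_(y in Q) K%:E)%E; last first.
  by rewrite integral_cst//= volQ -EFinM /K; congr EFin; ring.
apply: ge0_le_integral => //.
- exact: measurable_funS mf.
move=> y Qy; rewrite lee_fin.
rewrite (_ : K = d / 2 * (\sum_i `|z ord0 i|) * c); last by rewrite /K; ring.
rewrite ler_pM//.
- by rewrite mulr_ge0 ?sumr_ge0// divr_ge0// ltW.
- exact: ltW.
- rewrite le_max mulr_sumr; apply/orP; left.
  by apply: ler_sum => i _; exact: (Qd _ Qy i).2.
- by apply: (dcP y _).2 => i; exact: (Qd _ Qy i).1.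
Qed.

(** * Finite energy and coercivity of the Ding functional *)

(** [legendre phi] is bounded below by [- phi 0], so on a set of finite volume
    its negative part has a finite integral, and a bound of its integral from
    above makes it integrable; the factor [ell] is bounded on [P]. *)
Lemma integrable_legendreM (R : realType) n (P : set 'rV[R]_n) ell phi :
  polytope P -> P !=set0 -> affine_fun ell -> finite_energy P phi ->
  (lebesgue_rV n).-integrable P (fun y => legendre phi y * (ell y)%:E)%E.
Proof.
move=> pP P0 aell [_ fE].
have mP := measurable_polytope pP P0.
have mphi : measurable_fun P (legendre phi).
  exact: measurable_funTS (@measurable_legendre _ _ phi).
have legN y : ((legendre phi)^\- y <= `|phi 0|%:E)%E.
  rewrite funenegE ge_max lee_fin normr_ge0 andbT leeNl.
  apply: le_trans (le_legendre phi 0 y).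
  have -> : dotr 0 y = 0 by rewrite /dotr big1// => i _; rewrite mxE mul0r.
  by rewrite sub0r -EFinN lee_fin lerN2 ler_norm.
have intN : (\int[lebesgue_rV n]_(y in P) (legendre phi)^\- y < +oo)%E.
  apply: (@le_lt_trans _ _ (\int[lebesgue_rV n]_(y in P) `|phi 0|%:E)%E).
    by apply: ge0_le_integral => //; exact: measurable_funeneg.
  rewrite integral_cst//= lte_mul_pinfty// ?lee_fin//.
  exact: volume_polytope_fin.
have iphi : (lebesgue_rV n).-integrable P (legendre phi).
  apply/integrableP; split=> //.
  rewrite (eq_integral (fun y => (legendre phi)^\+ y + (legendre phi)^\- y)%E).
    2: by move=> y _; rewrite -[LHS]/((abse \o legendre phi) y) fune_abse.
  rewrite ge0_integralD//; [|exact: measurable_funepos|exact: measurable_funeneg].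
  apply: lte_add_pinfty => //.
  have fE' : (\int[lebesgue_rV n]_(y in P) legendre phi y < +oo)%E := fE.
  rewrite integralE in fE'; move: fE' intN.
  have : (0 <= \int[lebesgue_rV n]_(y in P) (legendre phi)^\- y)%E.
    exact: integral_ge0.
  case: (integral _ _ _) => [u| |]//; case: (integral _ _ _) => [v| |]//=.
  by rewrite !ltry.
have [L ellL] := affine_norm_bounded_polytope pP aell.
apply: (@le_integrable _ _ _ _ _ mP _ (fun y => L%:E * legendre phi y)%E).
- apply: emeasurable_funM => //.
  by apply/measurable_EFinP/measurable_funTS; exact: measurable_affine.
- move=> y Py; rewrite !abseM muleC lee_wpmul2r// lee_fin.
  by rewrite (le_trans (ellL _ Py))// ler_norm.
- exact: integrableZl.
Qed.

(** The energy integral that occurs in the reduced J-functional. *)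
Definition tilted_energy (R : realType) n (P : set 'rV[R]_n)
    (ell phi l : 'rV[R]_n -> R) : \bar R :=
  (\int[lebesgue_rV n]_(y in P) ((legendre phi y - (l y)%:E) * (ell y)%:E))%E.

(** The Ricci condition evaluates the integral of [l * ell] as [l 0]. *)
Lemma tilted_energyE (R : realType) n (P : set 'rV[R]_n) ell phi l :
  polytope P -> P !=set0 -> is_ricci_affine P ell -> finite_energy P phi ->
  affine_fun l ->
  (tilted_energy P ell phi l =
   \int[lebesgue_rV n]_(y in P) (legendre phi y * (ell y)%:E) - (l 0)%:E)%E.
Proof.
move=> pP P0 rP fE al.
rewrite -(integral_ricci rP al) -integralB//.
- apply: eq_integral => y _; rewrite EFinM muleBl//.
  by rewrite fin_num_adde_defl.
- exact: measurable_polytope.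
- exact: integrable_legendreM rP.1 fE.
- exact: integrable_affineM rP.1.
Qed.

Lemma energy_fin_num (R : realType) n (P : set 'rV[R]_n) ell phi :
  polytope P -> P !=set0 -> affine_fun ell -> finite_energy P phi ->
  (\int[lebesgue_rV n]_(y in P) (legendre phi y * (ell y)%:E))%E \is a fin_num.
Proof.
move=> pP P0 aell fE; apply: integrable_fin_num.
  exact: measurable_polytope.
exact: integrable_legendreM.
Qed.

Lemma legendre_tilt_ge0 (R : realType) n (phi : 'rV[R]_n -> R) a y :
  (0 <= legendre phi y - (dotr a y - phi a)%:E)%E.
Proof. by rewrite sube_ge0 ?le_legendre. Qed.

Lemma tilted_energy_ge0 (R : realType) n (P : set 'rV[R]_n) ell phi a :
  (forall y, P y -> 0 <= ell y) ->
  (0 <= tilted_energy P ell phi (fun y => dotr a y - phi a)%R)%E.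
Proof.
move=> ell0; apply: integral_ge0 => y Py.
by rewrite mule_ge0 ?legendre_tilt_ge0 ?lee_fin ?ell0.
Qed.

(** The energy tilted by [l_x(y) = <x, y> - phi(x)] is nonnegative and equals
    the energy plus [phi x], which bounds [phi] below. *)
Lemma finite_energy_almost_min (R : realType) n (P : set 'rV[R]_n) ell phi :
  polytope P -> P !=set0 -> is_ricci_affine P ell ->
  (forall y, P y -> 0 <= ell y) -> finite_energy P phi ->
  exists a, forall x, phi a <= phi x + 1.
Proof.
move=> pP P0 rP ell0 fE.
have lb x :
    - fine (\int[lebesgue_rV n]_(y in P) (legendre phi y * (ell y)%:E))%E <= phi x.
  have := tilted_energy_ge0 phi x ell0.
  rewrite (tilted_energyE pP P0 rP fE (affine_dotrB x (phi x))) dotr0 sub0r.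
  by rewrite -(fineK (energy_fin_num pP P0 rP.1 fE)) -EFinB lee_fin; lra.
have hi : has_inf (range phi).
  by split; [exists (phi 0), 0 | eexists => _ [x _ <-]; exact: lb].
have [_ [a _ <-] aP] := inf_adherent ltr01 hi.
exists a => x; rewrite (le_trans (ltW aP))// lerD2r.
by apply: ge_inf; [exact: hi.2 | exists x].
Qed.

(** Integrate over [y], against [ell dy] of mass 1, the inequality
    [(phi x - phi a + 1) + (phi^* y - <a, y> + phi a) >= max(<x - a, y>, 0)].
    It combines Young's inequality with the nonnegativity of both summands on
    the left. *)
Lemma growth_almost_min (R : realType) n (P : set 'rV[R]_n) ell phi (r : R) a x :
  polytope P -> P !=set0 -> is_ricci_affine P ell ->
  (forall y, P y -> 0 <= ell y) -> finite_energy P phi ->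
  (forall z : 'rV[R]_n, ((r * \sum_i `|z ord0 i|)%:E <=
     \int[lebesgue_rV n]_(y in P) (Num.max (dotr z y) 0 * ell y)%:E)%E) ->
  phi a <= phi x + 1 ->
  ((r * \sum_i `|x ord0 i - a ord0 i|)%:E <=
   (phi x - phi a + 1)%:E + tilted_energy P ell phi (fun y => dotr a y - phi a)%R)%E.
Proof.
move=> pP P0 rP ell0 fE rz ax.
have mP := measurable_polytope pP P0.
have mell : measurable_fun P (EFin \o ell).
  by apply/measurable_EFinP/measurable_funTS; exact: measurable_affine rP.1.
have u0 : 0 <= phi x - phi a + 1 by move: ax; lra.
rewrite (_ : \sum_i _ = \sum_i `|(x - a) ord0 i|); last first.
  by apply: eq_bigr => i _; rewrite !mxE.
apply: (le_trans (rz (x - a))).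
have -> : ((phi x - phi a + 1)%:E =
    \int[lebesgue_rV n]_(y in P) ((phi x - phi a + 1) * ell y)%:E)%E.
  by rewrite (integral_ricci rP (affine_cst n (phi x - phi a + 1))).
rewrite /tilted_energy -ge0_integralD//; last 4 first.
- by move=> y Py; rewrite lee_fin mulr_ge0// ell0.
- under eq_fun do rewrite EFinM.
  exact: emeasurable_funM.
- by move=> y Py; rewrite mule_ge0 ?legendre_tilt_ge0 ?lee_fin ?ell0.
- apply: emeasurable_funM => //; apply: emeasurable_funB.
    exact: measurable_funTS (@measurable_legendre _ _ phi).
  apply/measurable_EFinP/measurable_funTS.
  exact: measurable_affine (affine_dotrB _ _).
have mleg : measurable_fun P (legendre phi).
  exact: measurable_funTS (@measurable_legendre _ _ phi).
have mdot b : measurable_fun P (dotr b).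
  by apply: measurable_funTS; apply: measurable_affine; exists b, 0 => y; rewrite addr0.
apply: ge0_le_integral => //.
- by move=> y Py; rewrite lee_fin mulr_ge0 ?ell0// le_max lexx orbT.
- under eq_fun do rewrite EFinM.
  apply: emeasurable_funM => //; apply/measurable_EFinP.
  exact: measurable_maxr.
- apply: emeasurable_funD.
    under eq_fun do rewrite EFinM.
    exact: emeasurable_funM.
  apply: emeasurable_funM => //; apply: emeasurable_funB => //.
  by apply/measurable_EFinP/measurable_funB.
move=> y Py; rewrite EFinM EFinM -ge0_muleDl ?lee_fin ?legendre_tilt_ge0//.
rewrite lee_wpmul2r ?lee_fin ?ell0// EFin_max ge_max; apply/andP; split; last first.
  by rewrite adde_ge0 ?lee_fin ?legendre_tilt_ge0.
apply: (@le_trans _ _ ((phi x - phi a + 1)%:E +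
    ((dotr x y - phi x)%:E - (dotr a y - phi a)%:E))%E).
  rewrite -!EFinB -EFinD lee_fin.
  have -> : dotr (x - a) y = dotr x y - dotr a y.
    by rewrite /dotr -sumrB; apply: eq_bigr => i _; rewrite !mxE; ring.
  lra.
by rewrite leeD2l// leeD2r// le_legendre.
Qed.

(** Shrinking the exponent [phi x - phi a + 1 >= 0] by the factor [1 - eps]
    before applying the growth estimate leaves the energy in [log Z] with
    coefficient [1 - eps], while it enters the Ding functional with
    coefficient 1; the difference is [eps]. *)
Lemma ding_coercive (R : realType) n (P : set 'rV[R]_n) ell (eps : R) :
  polytope P -> interior P 0 -> is_ricci_affine P ell ->
  (forall y, P y -> 0 <= ell y) -> 0 <= eps -> eps < 1 ->
  exists2 C : R, 0 < C & forall phi a, finite_energy P phi ->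
    (forall x, phi a <= phi x + 1) ->
    (eps%:E * tilted_energy P ell phi (fun y => dotr a y - phi a)%R - C%:E
      <= ding P ell phi)%E.
Proof.
move=> pP iP rP ell0 eps0 eps1.
have P0 : P !=set0 by exists 0; exact: nbhs_singleton iP.
have [r r0 rz] := integral_dotr_pos_ge pP iP rP ell0.
pose k := (1 - eps) * r.
have k0 : 0 < k by rewrite mulr_gt0// subr_gt0.
pose K := (2 / k) ^+ n.
have K0 : 0 < K by rewrite exprn_gt0// divr_gt0.
exists (1 + `|ln K|) => [|phi a fE a_min]; first by rewrite ltr_pwDl.
pose I := fine (\int[lebesgue_rV n]_(y in P) (legendre phi y * (ell y)%:E))%E.
have IE : (\int[lebesgue_rV n]_(y in P) (legendre phi y * (ell y)%:E) = I%:E)%E.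
  by rewrite fineK//; exact: energy_fin_num rP.1 fE.
pose m := I + phi a.
have mE : (tilted_energy P ell phi (fun y => dotr a y - phi a)%R = m%:E)%E.
  rewrite tilted_energyE//; last exact: affine_dotrB.
  by rewrite dotr0 sub0r IE -EFinB opprK.
have growth (x : 'rV[R]_n) : r * \sum_i `|x ord0 i - a ord0 i| <= phi x - phi a + 1 + m.
  rewrite -lee_fin EFinD -mE.
  exact: growth_almost_min (rz) (a_min x).
pose A := (1 - eps) * m + 1 - phi a.
have Zle : (\int[lebesgue_rV n]_x (expR (- phi x))%:E <= (expR (A + ln K))%:E)%E.
  rewrite expRD lnK ?posrE// EFinM /K -(integral_expR_l1 a k0) -ge0_integralZl//.
    2: exact: measurable_expR_l1.
  apply: le_ge0_integral => x; first by rewrite lee_fin expR_ge0.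
  rewrite -EFinM lee_fin -expRD ler_expR /A /k.
  have := growth x; have := a_min x.
  set S := \sum_i _; set u := phi x - phi a + 1 => axu Su.
  have u0 : 0 <= eps * u by rewrite mulr_ge0// /u; lra.
  have : 0 <= (1 - eps) * (u + m - r * S).
    by rewrite mulr_ge0 ?subr_ge0// ltW.
  by move: u0; rewrite /u; lra.
rewrite mE /ding IE; apply: (@le_trans _ _ (- (A + ln K)%:E + I%:E)%E).
  rewrite -EFinM -EFinB -EFinN -EFinD lee_fin /A /m.
  have := ler_norm (ln K); lra.
have <- : lne (expR (A + ln K))%:E = (A + ln K)%:E := expeRK (A + ln K)%:E.
rewrite leeD2r// leeN2 lee_lne// in_itv/= leey andbT.
- by apply: integral_ge0 => x _; rewrite lee_fin expR_ge0.
- by rewrite lee_fin expR_ge0.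
Qed.

Theorem theorem40 (R : realType) (n : nat) (P : set 'rV[R]_n)
    (ell : 'rV[R]_n -> R) :
  polytope P -> interior P 0 -> is_ricci_affine P ell ->
  (forall y, P y -> 0 <= ell y) ->
  (forall eps : R, 0 < eps -> eps < 1 ->
    exists C : R, [/\ 0 < C,
      (forall phi : 'rV[R]_n -> R, finite_energy P phi ->
        phi 0 = 0 -> (forall x, phi 0 <= phi x) ->
        (eps%:E * \int[lebesgue_rV n]_(y in P) (legendre phi y * (ell y)%:E)
           - C%:E <= ding P ell phi)%E) &
      (forall phi : 'rV[R]_n -> R, finite_energy P phi ->
        (eps%:E * reduced_J P ell phi - C%:E <= ding P ell phi)%E)]) /\
  (exists M : R, forall phi : 'rV[R]_n -> R, finite_energy P phi ->
    (M%:E <= ding P ell phi)%E).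
Proof.
move=> pP iP rP ell0.
have P0 : P !=set0 by exists 0; exact: nbhs_singleton iP.
split=> [eps eps0 eps1|].
  have [C C0 dingC] := ding_coercive pP iP rP ell0 (ltW eps0) eps1.
  exists C; split=> // phi fE => [phi0 phi_min|].
    have phi_min1 x : phi 0 <= phi x + 1 by rewrite (le_trans (phi_min x))// lerDl.
    apply: le_trans (dingC phi 0 fE phi_min1); rewrite leeD2r// lee_wpmul2l//.
      by rewrite lee_fin ltW.
    rewrite tilted_energyE//; last exact: affine_dotrB.
    by rewrite dotr0 phi0 subrr sube0.
  have [a a_min] := finite_energy_almost_min pP P0 rP ell0 fE.
  apply: le_trans (dingC phi a fE a_min); rewrite leeD2r// lee_wpmul2l//.
    by rewrite lee_fin ltW.
  rewrite /reduced_J /tilted_energy.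
  apply: le_trans.
    apply: ereal_inf_lbound; exists (fun y => dotr a y - phi a) => //.
    exact: affine_dotrB.
  rewrite -[leRHS]adde0 leeD2l// leeNl oppe0.
  apply: le_ereal_inf_tmp => _ [y Py <-].
  exact: legendre_tilt_ge0.
have [C C0 dingC] := @ding_coercive _ _ _ _ (2^-1) pP iP rP ell0 ltac:(lra) ltac:(lra).
exists (- C) => phi fE.
have [a a_min] := finite_energy_almost_min pP P0 rP ell0 fE.
apply: le_trans (dingC phi a fE a_min).
by rewrite EFinN leeDr// mule_ge0 ?tilted_energy_ge0// lee_fin.
Qed.
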